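(* Let $\Gamma=(X,R)$ be a bipartite distance-regular graph with diameter $D\ge 4$, valency $k\ge 3$, intersection numbers $b_i,c_i$ and eigenvalues $\theta_0>\theta_1>\cdots>\theta_D$. Put $d=\lfloor D/2\rfloor$ and fix a vertex $x\in X$. Let $\eta_1,\eta_2,\ldots,\eta_{k_2}$ be the local eigenvalues of $\Gamma$ with respect to $x$, ordered so that $\eta_1=p^2_{22}$ and $\eta_i=b_3-1$ for $2\le i\le k$. Then $$\tilde\theta_1\le \eta_i\le\tilde\theta_d\qquad (k+1\le i\le k_2),$$ where $\tilde\theta_1=-1-\dfrac{b_2b_3}{\theta_1^2-b_2}$ and $\tilde\theta_d=-1-\dfrac{b_2b_3}{\theta_d^2-b_2}$.
   Context: Graphs are finite, undirected, connected, without loops or multiple edges; $\partial$ denotes path-length distance. A graph $\Gamma=(X,R)$ of diameter $D$ is distance-regular if for all $0\le h,i,j\le D$ and all $x,y\in X$ with $\partial(x,y)=h$ the number $p^h_{ij}=|\{z\in X:\partial(x,z)=i,\ \partial(z,y)=j\}|$ depends only on $h,i,j$. Write $c_i=p^i_{1,i-1}$ $(1\le i\le D)$, $b_i=p^i_{1,i+1}$ $(0\le i\le D-1)$, $k=b_0$ (the valency), $k_i=p^0_{ii}$ (the $i$th valency). $\Gamma$ is bipartite if $X$ can be partitioned into two subsets neither of which contains an edge. The eigenvalues of $\Gamma$ are the distinct eigenvalues of its adjacency matrix; there are $D+1$ of them, all real, indexed $\theta_0>\theta_1>\cdots>\theta_D$. For bipartite $\Gamma$ with $D\ge4$ one has $\theta_1^2>b_2>\theta_d^2$,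 so $\tilde\theta_1,\tilde\theta_d$ are well defined. Local eigenvalues: for fixed $x\in X$ let $\Gamma_2^2=\Gamma_2^2(x)$ be the graph with vertex set $\{y\in X:\partial(x,y)=2\}$ in which $y,z$ are adjacent iff $\partial(y,z)=2$ (distance in $\Gamma$). It has $k_2$ vertices and is regular with valency $p^2_{22}$. The eigenvalues (with multiplicity) $\eta_1,\ldots,\eta_{k_2}$ of its adjacency matrix are the local eigenvalues of $\Gamma$ with respect to $x$. It is known that they can be ordered so that $\eta_1=p^2_{22}$ and $\eta_i=b_3-1$ for $2\le i\le k$; this ordering is assumed. *)

(* Defs.v *)
From HB Require Import structures.
From mathcomp Require Import all_boot all_order all_algebra.

Set Implicit Arguments.
Unset Strict Implicit.
Unset Printing Implicit Defensive.

Import Order.TTheory GRing.Theory Num.Theory.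

Local Open Scope ring_scope.

Section Graphs.

Variables (X : finType) (e : rel X).

(* A shortest walk has fewer than #|X| edges, so searching lengths below #|X|
   suffices; the value is #|X| when no walk joins x to y. *)
Definition dist (x y : X) : nat :=
  find (fun n => [exists s : n.-tuple X, path e x s && (last x s == y)])
       (iota 0 #|X|).

Definition diameter : nat := (\max_(u : X * X) dist u.1 u.2)%N.

Definition simple_connected_graph : Prop :=
  [/\ symmetric e, irreflexive e & forall x y, connect e x y].

Definition bipartite : Prop :=
  exists A : {set X},
    (forall x y, x \in A -> y \in A -> ~~ e x y) /\
    (forall x y, x \in ~: A -> y \in ~: A -> ~~ e x y).

(* The graph is distance-regular and p h i j is p^h_{ij}.  The values of p are
   determined, and constrained, only for h, i, j up to the diameter. *)
Definition distance_regular (p : nat -> nat -> nat -> nat) : Prop :=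
  forall h i j : nat,
    (h <= diameter)%N -> (i <= diameter)%N -> (j <= diameter)%N ->
    forall x y : X, dist x y = h ->
      #|[set z | (dist x z == i) && (dist z y == j)]| = p h i j.

End Graphs.

Section IntersectionNumbers.

Variable p : nat -> nat -> nat -> nat.

Definition inter_b (i : nat) : nat := p i 1%N i.+1.
Definition valency : nat := inter_b 0.
Definition ith_valency (i : nat) : nat := p 0%N i i.

End IntersectionNumbers.

Definition adjmx (R : nzRingType) (V : finType) (r : rel V) : 'M[R]_#|V| :=
  \matrix_(i, j) (r (enum_val i) (enum_val j))%:R.

Section LocalGraph.

Variables (X : finType) (e : rel X) (x : X).

Definition local_vertex : finType := {y : X | dist e x y == 2%N}.

Definition local_rel : rel local_vertex :=
  [rel y z | dist e (val y) (val z) == 2%N].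

End LocalGraph.

Arguments local_rel {X} e x.

(* theta 0 > ... > theta D are exactly the distinct eigenvalues of A. *)
Definition distinct_eigenvalues (R : realFieldType) (n : nat) (A : 'M[R]_n)
    (D : nat) (theta : nat -> R) : Prop :=
  (forall i j, (i < j)%N -> (j <= D)%N -> theta j < theta i) /\
  (forall a, eigenvalue A a <-> exists2 i, (i <= D)%N & theta i = a).

(* eta 1, ..., eta m are the eigenvalues of A counted with multiplicity. *)
Definition eigenvalues_with_mult (R : realFieldType) (n : nat) (A : 'M[R]_n)
    (m : nat) (eta : nat -> R) : Prop :=
  char_poly A = \prod_(1 <= i < m.+1) ('X - (eta i)%:P).

Definition theta_tilde (R : realFieldType) (p : nat -> nat -> nat -> nat)
    (t : R) : R :=
  - 1 - (inter_b p 2)%:R * (inter_b p 3)%:R / (t ^+ 2 - (inter_b p 2)%:R).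

(* Main.v *)
Require Import Defs.
From HB Require Import structures.
From mathcomp Require Import all_boot all_order all_algebra.
From mathcomp Require Import ring lra zify.

Set Implicit Arguments.
Unset Strict Implicit.
Unset Printing Implicit Defensive.

Import Order.TTheory GRing.Theory Num.Theory.

Local Open Scope ring_scope.

(** Work in the halved graph, whose edges join the vertices of one bipartition
    class that lie at distance 2.  The graph induced on Gamma_2(x) is its local
    graph, and A^2 = c_2 H + k with H the adjacency matrix of the halved graph;
    in terms of the eigenvalues of H the theorem is Terwilliger's bound on the
    eigenvalues of a local graph.

    Let theta be an eigenvalue of A with theta^2 < k^2, and E the projection
    onto its eigenspace.  E is a polynomial in A, so its (y, z) entry is f_h
    with h the distance of y and z, and A E = theta E is a three-term recurrence
    for f.  Let w be an eigenvector, for the value eta, of the graph on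
    Gamma_2(x), orthogonal to the constants and extended by zero to X.  Two
    vertices of Gamma_2(x) are at distance 0, 2 or 4, so
      0 <= |E w|^2 = (f_0 + eta f_2 - (1 + eta) f_4) |w|^2.
    The recurrence gives
      b_2 b_3 (f_2 - f_4) = (f_0 - f_2) (theta^2 - b_2)  and  f_0 > f_2,
    and the inequality turns into
      0 <= b_2 b_3 + (eta + 1) (theta^2 - b_2)
    ([local_eigenvalue_bound]).  For theta = theta_1 and theta = theta_d this is
    the lower and the upper bound, provided theta_1^2 > b_2 > theta_d^2.

    These two strict inequalities come from the same source of positivity: a
    polynomial g that is nonnegative at every theta_i makes g(A) the square of a
    symmetric matrix ([kernel_square]).  Were theta_1^2 <= b_2, this would apply
    to (X^2 - b_2)(X^2 - k^2); at A the diagonal of that polynomial vanishes, so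
    the whole matrix would, but its entries at distance 4 are c_4 c_3 c_2.  Were
    theta_d^2 >= b_2, it would apply to X^2 - b_2, but the quadratic form of
    A^2 - b_2 is negative at (1, -2, 1) placed on a geodesic of the halved graph.

    What makes polynomials in A computable is that A acts on the matrices whose
    entries depend on the distance only, through the matrix T with entries
    p^h_{1j}.  By Cayley and Hamilton the characteristic polynomial of T, of
    degree D + 1, annihilates A; having the D + 1 numbers theta_i as roots it is
    their product of linear factors, and a polynomial in A depends only on its
    values at the theta_i.

    Finally, eta_1 is the valency of the graph on Gamma_2(x), and each eta_i
    with i >= 2 has an eigenvector orthogonal to the constants
    ([regular_cofactor_eigenvector]). *)

(** * Path-length distance *)

Section Distance.

Variables (X : finType) (e : rel X).
Hypothesis he : simple_connected_graph e.

Let e_sym : symmetric e. Proof. by case: he. Qed.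

Definition walk (n : nat) (x y : X) : bool :=
  [exists s : n.-tuple X, path e x s && (last x s == y)].

Lemma walkP n x y :
  reflect (exists s, [/\ size s = n, path e x s & last x s = y]) (walk n x y).
Proof.
apply: (iffP existsP) => [[s /andP[es /eqP xs]]|[s [sn es xs]]].
  by exists s; rewrite size_tuple.
by move/eqP: sn => sn; exists (Tuple sn); rewrite /= es xs eqxx.
Qed.

Lemma walk_dist_lt x y : (dist e x y < #|X|)%N /\ walk (dist e x y) x y.
Proof.
have [_ _ /(_ x y)/connectP[s0 es0 ->]] := he.
case/shortenP: es0 => s es us _.
have sX : (size s < #|X|)%N.
  by rewrite -[(size s).+1]/(size (x :: s)) -(card_uniqP us) max_card.
have hs : has (fun n => walk n x (last x s)) (iota 0 #|X|).
  by apply/hasP; exists (size s); rewrite ?mem_iota //; apply/walkP; exists s.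
have d_lt : (dist e x (last x s) < #|X|)%N by rewrite -[ltnRHS](size_iota 0) -has_find.
split=> //; have := nth_find 0%N hs.
by rewrite nth_iota.
Qed.

Lemma walk_dist x y : walk (dist e x y) x y.
Proof. by case: (walk_dist_lt x y). Qed.

Lemma dist_le_walk n x y : walk n x y -> (dist e x y <= n)%N.
Proof.
move=> w; case: (ltnP n #|X|) => [n_lt|]; last first.
  by apply: leq_trans; apply: ltnW; case: (walk_dist_lt x y).
rewrite leqNgt; apply/negP => /(before_find 0%N).
by rewrite nth_iota //= -/(walk n x y) w.
Qed.

Lemma walk_sym n x y : walk n x y -> walk n y x.
Proof.
case/walkP => s [sn es <-]; apply/walkP; exists (rev (belast x s)).
split; first by rewrite size_rev size_belast.
  by rewrite rev_path (eq_path (e' := e)).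
by case: s {sn es} => //= a s; rewrite rev_cons last_rcons.
Qed.

Lemma dist_sym x y : dist e x y = dist e y x.
Proof.
by apply/eqP; rewrite eqn_leq !dist_le_walk // walk_sym // walk_dist.
Qed.

Lemma dist_xx x : dist e x x = 0%N.
Proof.
by apply/eqP; rewrite -leqn0; apply: dist_le_walk; apply/walkP; exists [::].
Qed.

Lemma dist_eq0 x y : (dist e x y == 0%N) = (x == y).
Proof.
apply/eqP/eqP => [d0|->]; last exact: dist_xx.
by have := walk_dist x y; rewrite d0 => /walkP[[|? ?]] [].
Qed.

Lemma dist_triangle y x z : (dist e x z <= dist e x y + dist e y z)%N.
Proof.
have /walkP[s [<- es <-]] := walk_dist x y.
have /walkP[t [<- et <-]] := walk_dist (last x s) z.
apply: dist_le_walk; apply/walkP; exists (s ++ t).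
by rewrite size_cat cat_path last_cat es et.
Qed.

Lemma dist_split m n x z : dist e x z = (m + n)%N ->
  exists2 y, dist e x y = m & dist e y z = n.
Proof.
move=> dmn; have /walkP[s [ss es lz]] := walk_dist x z.
have le1 : (dist e x (last x (take m s)) <= m)%N.
  apply: dist_le_walk; apply/walkP; exists (take m s); split=> //.
    by rewrite size_takel // ss dmn leq_addr.
  by move: es; rewrite -{1}(cat_take_drop m s) cat_path => /andP[].
have le2 : (dist e (last x (take m s)) z <= n)%N.
  apply: dist_le_walk; apply/walkP; exists (drop m s); split=> //.
  - by rewrite size_drop ss dmn addKn.
  - by move: es; rewrite -{1}(cat_take_drop m s) cat_path => /andP[].
  - by rewrite -last_cat cat_take_drop.
exists (last x (take m s)); have := dist_triangle (last x (take m s)) x z; lia.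
Qed.

Lemma dist_eq1 x y : (dist e x y == 1%N) = e x y.
Proof.
have [_ e_irr _] := he.
apply/eqP/idP => [d1|exy].
  have := walk_dist x y; rewrite d1 => /walkP[[|a [|b s]]] [] //= _.
  by rewrite andbT => exa <-.
apply/eqP; rewrite eqn_leq; apply/andP; split.
  by apply: dist_le_walk; apply/walkP; exists [:: y]; rewrite /= exy.
by rewrite lt0n dist_eq0; apply: contraL exy => /eqP->; rewrite e_irr.
Qed.

Lemma dist_le_diameter x y : (dist e x y <= diameter e)%N.
Proof. exact: (leq_bigmax (x, y)). Qed.

Lemma exists_dist h (x0 : X) : (h <= diameter e)%N -> exists x y, dist e x y = h.
Proof.
move=> hD; have X0 : (0 < #|{: X * X}|)%N by apply/card_gt0P; exists (x0, x0).
have [[x z]] := bigop.eq_bigmax (fun u : X * X => dist e u.1 u.2) X0.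
rewrite -/(diameter e) /= => /esym dxz.
have [|y dxy _] := @dist_split h (diameter e - h)%N x z; first by rewrite subnKC.
by exists x, y.
Qed.

(** In a bipartite graph the length of a walk is even exactly when its ends
    have the same colour, and the three pairs among x, y, z differ in colour an
    even number of times. *)
Lemma odd_dist : bipartite e -> forall x y z,
  odd (dist e y z) = odd (dist e x y) (+) odd (dist e x z).
Proof.
case=> C [hC hC'].
have col y z : e y z -> (z \in C) = ~~ (y \in C).
  move=> eyz; case: (boolP (y \in C)) => yC; case: (boolP (z \in C)) => zC //=.
    by have := hC _ _ yC zC; rewrite eyz.
  by have := hC' y z; rewrite !inE yC zC eyz => /(_ isT isT).
have colp s y : path e y s -> (last y s \in C) = odd (size s) (+) (y \in C).
  elim: s y => //= z s IH y /andP[eyz /IH ->].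
  by rewrite (col _ _ eyz); case: (odd _); case: (y \in C).
have odd_col y z : odd (dist e y z) = (y \in C) (+) (z \in C).
  have /walkP[s [<- es <-]] := walk_dist y z; rewrite colp //.
  by case: (odd _); case: (y \in C).
move=> x y z; rewrite !odd_col.
by case: (x \in C); case: (y \in C); case: (z \in C).
Qed.

End Distance.

(** * Functions of a matrix with known annihilating polynomial *)

(** Newton's scheme: the correction added for the last node vanishes at the
    earlier ones. *)
Lemma interpolation (F : fieldType) (m : nat) (t c : nat -> F) :
  {in gtn m &, injective t} ->
  exists q : {poly F}, forall i, (i < m)%N -> q.[t i] = c i.
Proof.
elim: m => [|m IH] t_inj; first by exists 0.
have [|q qE] := IH.
  by move=> i j im jm; apply: t_inj; rewrite inE ltnW.
pose N := \prod_(i < m) ('X - (t i)%:P).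
have N0 i : (i < m)%N -> N.[t i] = 0.
  move=> im; rewrite horner_prod (bigD1 (Ordinal im)) //=.
  by rewrite hornerXsubC subrr mul0r.
have Nm : N.[t m] != 0.
  rewrite horner_prod; apply/prodf_neq0 => i _.
  rewrite hornerXsubC subr_eq0; apply/eqP => /t_inj.
  rewrite !inE ltnSn ltnS (ltnW (ltn_ord i)) => /(_ isT isT) mi.
  by have := ltn_ord i; rewrite -mi ltnn.
exists (q + ((c m - q.[t m]) / N.[t m])%:P * N) => i.
rewrite ltnS leq_eqVlt => /orP[/eqP->|im].
  by rewrite hornerD hornerM hornerC divfK // addrC subrK.
by rewrite hornerD hornerM (N0 i im) mulr0 addr0 qE.
Qed.

Section MatrixFunctions.

Variables (F : fieldType) (n m : nat) (A : 'M[F]_n.+1) (t : nat -> F).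
Hypothesis t_inj : {in gtn m &, injective t}.
Hypothesis tA : horner_mx A (\prod_(i < m) ('X - (t i)%:P)) = 0.

(** A difference that vanishes at all t_i is a multiple of the annihilating
    polynomial. *)
Lemma eq_horner_mx p q : (forall i, (i < m)%N -> p.[t i] = q.[t i]) ->
  horner_mx A p = horner_mx A q.
Proof.
move=> pq; apply/eqP; rewrite -subr_eq0 -rmorphB.
have /dvdpP[u ->] : \prod_(z <- [seq t i | i <- iota 0 m]) ('X - z%:P) %| p - q.
  apply: uniq_roots_dvdp.
    apply/allP => _ /mapP[i im ->]; rewrite mem_iota in im.
    by rewrite /root !hornerE pq // subrr.
  rewrite uniq_rootsE map_inj_in_uniq ?iota_uniq //.
  by move=> i j; rewrite !mem_iota; exact: t_inj.
rewrite rmorphM /= big_map -{1}(subn0 m) -/(index_iota 0 m) big_mkord.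
by rewrite tA mulr0.
Qed.

End MatrixFunctions.

Lemma trmx_horner_mx (F : comNzRingType) n (A : 'M[F]_n.+1) p :
  A^T = A -> (horner_mx A p)^T = horner_mx A p.
Proof.
move=> AT; elim/poly_ind: p => [|p c IH]; first by rewrite rmorph0 trmx0.
rewrite rmorphD rmorphM /= horner_mx_C horner_mx_X linearD /= tr_scalar_mx.
rewrite trmx_mul IH AT -[A *m _]/(A * _) -{1}(horner_mx_X A).
by rewrite comm_horner_mx2 horner_mx_X.
Qed.

(** Positivity without a spectral decomposition: take s interpolating the square
    roots of the values of g at the t_i; then s^2 and g agree at every t_i, hence
    at A. *)
Lemma horner_mx_square (R : rcfType) n m (A : 'M[R]_n.+1) (t : nat -> R) g :
  {in gtn m &, injective t} ->
  horner_mx A (\prod_(i < m) ('X - (t i)%:P)) = 0 ->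
  (forall i, (i < m)%N -> 0 <= g.[t i]) ->
  exists s, horner_mx A g = horner_mx A s *m horner_mx A s.
Proof.
move=> t_inj tA g0.
have [s sE] := interpolation (fun i => Num.sqrt g.[t i]) t_inj.
exists s; rewrite -[RHS]/(_ * _) -rmorphM; apply: (eq_horner_mx t_inj tA) => i im.
by rewrite hornerM sE // -expr2 sqr_sqrtr ?g0.
Qed.

(** A double root kappa is the reason for a change of basis: an eigenvector found
    from det (eta - M) = 0 alone could then be constant.  In the basis formed by
    the constant vector and the vectors e_i - e_0 the matrix becomes
    block diagonal with blocks kappa and B', so P is the characteristic
    polynomial of B', and eigenvectors of B' give vectors of sum zero. *)
Lemma regular_cofactor_eigenvector (F : numFieldType) n (M : 'M[F]_n)
    (kappa eta : F) (P : {poly F}) :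
  M^T = M -> (forall i, \sum_j M i j = kappa) ->
  char_poly M = ('X - kappa%:P) * P -> root P eta ->
  exists w : 'rV[F]_n, [/\ w != 0, w *m M = eta *: w & \sum_j w 0 j = 0].
Proof.
case: n M => [|n] /= M MT Mk Mchar Peta.
  move/(congr1 (horner^~ kappa)): Mchar.
  by rewrite /char_poly det_mx00 !hornerE subrr mul0r => /eqP; rewrite oner_eq0.
pose one : 'rV[F]_(1 + n) := const_mx 1.
pose C : 'M[F]_(n, 1 + n) := row_mx (const_mx (-1)) 1%:M.
pose S : 'M[F]_(1 + n) := col_mx one C.
have sumM (k : nat) (B : 'M[F]_(k, 1 + n)) i : (B *m one^T) i 0 = \sum_j B i j.
  by rewrite mxE; apply: eq_bigr => j _; rewrite !mxE mulr1.
have M1 : M *m one^T = kappa *: one^T.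
  by apply/matrixP=> i j; rewrite ord1 sumM Mk !mxE mulr1.
have oneM : one *m M = kappa *: one.
  by apply: trmx_inj; rewrite trmx_mul MT M1 linearZ.
have C1 : C *m one^T = 0.
  rewrite -[one](@hsubmxK _ _ 1 n) tr_row_mx mul_row_col mul1mx.
  by apply/matrixP=> i j; rewrite !mxE big_ord1 !mxE mulr1 addrC subrr.
have zeroC (k : nat) (B : 'M[F]_(k, 1 + n)) : B *m one^T = 0 -> B = rsubmx B *m C.
  move=> B1; rewrite mul_mx_row mulmx1 -[B in LHS](@hsubmxK _ _ 1 n); congr row_mx.
  apply/matrixP=> i j; move/matrixP: B1 => /(_ i 0); rewrite sumM mxE.
  rewrite big_split_ord big_ord1 /= => /eqP; rewrite addr_eq0 => /eqP B0.
  rewrite ord1 mxE B0 mxE -sumrN; apply: eq_bigr => l _.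
  by rewrite !mxE mulrN1.
pose B' := @rsubmx _ _ 1 n (C *m M).
have CM : C *m M = B' *m C.
  by apply: zeroC; rewrite -mulmxA M1 -scalemxAr C1 scaler0.
have SM : S *m M = block_mx kappa%:M 0 0 B' *m S.
  by rewrite mul_col_mx mul_block_col !mul0mx addr0 add0r mul_scalar_mx oneM CM.
have S_unit : S \in unitmx.
  rewrite -row_free_unit; apply: inj_row_free => a.
  rewrite -[a](@hsubmxK _ _ 1 n) mul_row_col => aS.
  have a0 : lsubmx a = 0.
    have : (lsubmx a *m one + rsubmx a *m C) *m one^T = 0 by rewrite aS mul0mx.
    rewrite mulmxDl -!mulmxA C1 mulmx0 addr0 => /matrixP/(_ 0 0).
    rewrite mxE big_ord1 sumM (eq_bigr (fun=> 1)) => [|j _]; last by rewrite mxE.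
    rewrite sumr_const card_ord [RHS]mxE => /eqP.
    rewrite mulf_eq0 pnatr_eq0 orbF => /eqP a00.
    by apply/matrixP=> i j; rewrite !ord1 a00 mxE.
  move: aS; rewrite a0 mul0mx add0r mul_mx_row mulmx1 => aS.
  by have := congr1 (@rsubmx _ _ 1 n) aS; rewrite row_mxKr linear0 => ->; rewrite row_mx0.
have charB : char_poly M = ('X - kappa%:P) * char_poly B'.
  have : \det (map_mx polyC S) * char_poly M =
      \det (map_mx polyC S) * (('X - kappa%:P) * char_poly B').
    pose K : 'M[F]_(1 + n) := block_mx kappa%:M 0 0 B'.
    have -> : ('X - kappa%:P) * char_poly B' = char_poly K.
      rewrite /char_poly /char_poly_mx (map_block_mx _ kappa%:M) !map_mx0.
      rewrite (scalar_mx_block 1 n 'X).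
      rewrite opp_block_mx add_block_mx !oppr0 !addr0 det_ublock map_scalar_mx.
      by rewrite -raddfB det_scalar1.
    have SK : map_mx polyC S *m char_poly_mx M =
              char_poly_mx K *m map_mx polyC S.
      rewrite /char_poly_mx mulmxBr mulmxBl scalar_mxC; congr (_ - _).
      by rewrite -!map_mxM /= SM.
    move/(congr1 determinant): SK; rewrite !det_mulmx => SK.
    by rewrite [RHS]mulrC; exact: SK.
  apply: mulfI; rewrite det_map_mx polyC_eq0 -unitfE.
  by rewrite -unitmxE.
have PB : P = char_poly B'.
  apply: (mulfI (x := 'X - kappa%:P)); first by rewrite polyXsubC_eq0.
  by rewrite -Mchar charB.
move: Peta; rewrite PB -eigenvalue_root_char => /eigenvalueP[z zB z0].
exists (z *m C); split.
- apply: contra z0; rewrite mul_mx_row mulmx1 => /eqP zC.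
  by have := congr1 (@rsubmx _ _ 1 n) zC; rewrite row_mxKr linear0 => ->.
- by rewrite -mulmxA CM mulmxA zB scalemxAl.
- by rewrite -sumM -mulmxA C1 mulmx0 mxE.
Qed.

Lemma sum_sqr_gt0 (R : realFieldType) (V : finType) (f : V -> R) y :
  f y != 0 -> 0 < \sum_z f z ^+ 2.
Proof.
move=> fy; rewrite (bigD1 y) //=; apply: ltr_wpDr.
  by apply: sumr_ge0 => z _; exact: sqr_ge0.
by rewrite lt_neqAle eq_sym sqrf_eq0 fy sqr_ge0.
Qed.

(** K y y is the sum of the squares of the s t y. *)
Lemma square_diag0 (R : realFieldType) (X : finType) (K s : X -> X -> R) y :
  (forall y z, K y z = \sum_t s t y * s t z) -> K y y = 0 ->
  forall z, K y z = 0.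
Proof.
move=> Ks; rewrite Ks => sy0 z; rewrite Ks big1 // => t _.
have : s t y * s t y == 0.
  move/eqP: sy0; rewrite psumr_eq0 => [/allP/(_ t)|u _]; last exact: sqr_ge0.
  by apply; rewrite mem_index_enum.
by rewrite mulf_eq0 orbb => /eqP->; rewrite mul0r.
Qed.

(** * Eigenvalues of graphs and counting of neighbours *)

Definition eigenfunction (R : nzRingType) (V : finType) (r : rel V) (a : R)
    (f : V -> R) : Prop :=
  (exists y, f y != 0) /\ forall y, \sum_z (r y z)%:R * f z = a * f y.

Lemma eigenvalue_adjmxP (R : realFieldType) (V : finType) (r : rel V) (a : R) :
  symmetric r ->
  (eigenvalue (adjmx R r) a <-> exists f : V -> R, eigenfunction r a f).
Proof.
move=> r_sym; split.
  case/eigenvalueP=> w wA w0; exists (fun y => w 0 (enum_rank y)); split.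
    case/rV0Pn: w0 => i wi; exists (enum_val i); by rewrite enum_valK.
  move=> y; move/rowP: wA => /(_ (enum_rank y)); rewrite !mxE => <-.
  rewrite (reindex (@enum_rank V)); last exact/onW_bij/enum_rank_bij.
  by apply: eq_bigr => z _; rewrite mxE !enum_rankK r_sym mulrC.
case=> f [[y fy] fA]; apply/eigenvalueP; exists (\row_i f (enum_val i)).
  apply/rowP=> i; rewrite !mxE -fA (reindex (@enum_rank V)) /=; last first.
    exact/onW_bij/enum_rank_bij.
  by apply: eq_bigr => z _; rewrite !mxE !enum_rankK r_sym mulrC.
by apply/rV0Pn; exists (enum_rank y); rewrite mxE enum_rankK.
Qed.

Section Kernels.

Variables (R : rcfType) (X : finType) (e : rel X) (p : nat -> nat -> nat -> nat).
Hypothesis he : simple_connected_graph e.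
Hypothesis hbip : bipartite e.
Hypothesis hdr : distance_regular e p.

Local Notation D := (diameter e).
Hypothesis hD : (4 <= D)%N.

Local Notation k := (valency p).
Local Notation b h := (p h 1%N h.+1).
Local Notation c h := (p h 1%N h.-1).

Variable x0 : X.

Let pair_at h : (h <= D)%N -> exists y z, dist e y z = h.
Proof. exact: exists_dist. Qed.

Let D_gt0 : (0 < D)%N. Proof. exact: leq_trans hD. Qed.

Lemma card_sphere_meet i j y z : (i <= D)%N -> (j <= D)%N ->
  #|[set w | (dist e y w == i) && (dist e w z == j)]| = p (dist e y z) i j.
Proof. by move=> iD jD; apply: hdr => //; exact: dist_le_diameter. Qed.

Lemma sum_neighbours (f : nat -> R) y z :
  \sum_w (e y w)%:R * f (dist e w z) =
  \sum_(j < D.+1) (p (dist e y z) 1%N j)%:R * f j.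
Proof.
rewrite (eq_bigr (fun w => \sum_(j < D.+1)
    ((dist e y w == 1%N) && (dist e w z == j))%:R * f j)); last first.
  move=> w _; have wz : (dist e w z < D.+1)%N by rewrite ltnS dist_le_diameter.
  rewrite (bigD1 (Ordinal wz)) //= eqxx andbT dist_eq1 // big1 ?addr0 // => j.
  rewrite -val_eqE /= eq_sym => /negbTE->.
  by rewrite andbF mul0r.
rewrite exchange_big; apply: eq_bigr => j _; rewrite -mulr_suml; congr (_ * _).
rewrite -card_sphere_meet //; last by rewrite -ltnS.
rewrite -sum1_card natr_sum [RHS]big_mkcond /=.
by apply: eq_bigr => w _; rewrite inE; case: ifP.
Qed.

(** The triangle inequality leaves j = h - 1, h, h + 1, and bipartiteness
    excludes j = h. *)
Lemma p_parity h j : (h <= D)%N -> (j <= D)%N ->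
  j != h.-1 -> j != h.+1 -> p h 1%N j = 0%N.
Proof.
move=> hh hj j1 j2; have [y [z yz]] := pair_at hh.
rewrite -yz -card_sphere_meet //.
apply: eq_card0 => w; rewrite !inE dist_eq1 //; apply/negP=> /andP[eyw /eqP dwz].
have dyw : dist e y w = 1%N by apply/eqP; rewrite dist_eq1.
have := odd_dist he hbip y w z; rewrite dwz dyw yz => od.
have := dist_triangle he w y z; have := dist_triangle he y w z.
rewrite [dist e w y]dist_sym // dyw dwz yz.
lia.
Qed.

(** The condition on f at D + 1 makes the formula hold at h = D too, where the
    term in h + 1 is not part of the sum. *)
Lemma sum_p h (f : nat -> R) : (0 < h <= D)%N -> f D.+1 = 0 ->
  \sum_(j < D.+1) (p h 1%N j)%:R * f j =
  (c h)%:R * f h.-1 + (b h)%:R * f h.+1.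
Proof.
case/andP=> h0 hh fD.
have h1 : (h.-1 < D.+1)%N by lia.
have [hD1|hD1] := ltnP h D; last first.
  have -> : h.+1 = D.+1 by lia.
  rewrite fD mulr0 addr0 (bigD1 (Ordinal h1)) //= big1 ?addr0 // => j.
  rewrite -val_eqE /= => j1; rewrite p_parity ?mul0r //; have := ltn_ord j; lia.
have h2 : (h.+1 < D.+1)%N by [].
rewrite (bigD1 (Ordinal h1)) //= (bigD1 (Ordinal h2)) /=; last by rewrite -val_eqE /=; lia.
rewrite big1 ?addr0 // => j; rewrite -!val_eqE /= => /andP[j1 j2].
rewrite p_parity ?mul0r //; have := ltn_ord j; lia.
Qed.

Lemma sum_p0 (f : nat -> R) :
  \sum_(j < D.+1) (p 0 1%N j)%:R * f j = k%:R * f 1%N.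
Proof.
have h1 : (1 < D.+1)%N by lia.
rewrite (bigD1 (Ordinal h1)) //= big1 ?addr0 // => j; rewrite -val_eqE /= => j1.
have [j0|j0] := eqVneq (j : nat) 0%N; last first.
  by rewrite p_parity ?mul0r //; have := ltn_ord j; lia.
rewrite j0 -[X in p X](dist_xx he x0) -card_sphere_meet //.
rewrite eq_card0 ?mul0r // => w; rewrite !inE dist_eq0 //.
by apply/andP=> -[/eqP + /eqP wx]; rewrite wx dist_xx.
Qed.

Lemma valencyE y : (\sum_w (e y w)%:R : R) = k%:R.
Proof.
have := sum_neighbours (fun=> 1) y y; rewrite dist_xx // (sum_p0 (fun=> 1)) mulr1 => <-.
by apply: eq_bigr => w _; rewrite mulr1.
Qed.

Lemma c_plus_b h : (0 < h < D)%N -> (c h + b h)%N = k.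
Proof.
case/andP=> h0 hh; have [y [z yz]] := pair_at (ltnW hh).
apply/eqP; rewrite -(eqr_nat R) -(valencyE y) natrD.
have := sum_neighbours (fun j => (j <= D)%:R) y z.
have hb : (h.-1 <= D)%N := leq_trans (leq_pred _) (ltnW hh).
rewrite yz (sum_p (f := fun j => (j <= D)%:R)); first last.
- by rewrite ltnn.
- by rewrite h0 ltnW.
rewrite hh hb !mulr1 => <-; apply/eqP.
by apply: eq_bigr => w _; rewrite dist_le_diameter mulr1.
Qed.

Lemma c_gt0 h : (0 < h <= D)%N -> (0 < c h)%N.
Proof.
case/andP=> h0 hh; have [y [z yz]] := pair_at hh.
have [|w yw wz] := @dist_split _ _ he 1 h.-1 y z; first by rewrite yz add1n prednK.
rewrite -[X in p X]yz -card_sphere_meet //; last by apply: leq_trans hh; rewrite leq_pred.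
by apply/card_gt0P; exists w; rewrite inE yw wz !eqxx.
Qed.

Lemma c1E : c 1 = 1%N.
Proof.
have [|y [z yz]] := @pair_at 1; first by [].
rewrite -[X in p X]yz -card_sphere_meet //.
rewrite -[RHS](cards1 z); apply: eq_card => w; rewrite !inE /= dist_eq0 //.
by apply/andP/eqP=> [[_ /eqP]|->] //; rewrite yz.
Qed.

(** * Polynomials in the adjacency matrix as functions of the distance *)

Definition inter_mx : 'M[R]_D.+1 := \matrix_(h, j) (p h 1%N j)%:R.

(** The value at distance h of the polynomial q in the adjacency matrix
    ([kernelE]).  Setting it to 0 beyond the diameter keeps the three-term
    recurrence [coef_at_mulXS] valid at h + 1 = D, whatever p D 1 D.+1 is. *)
Definition coef_at (q : {poly R}) (h : nat) : R :=
  if (h <= D)%N then horner_mx inter_mx q (inord h) ord0 else 0.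

Lemma coef_at_gtD q h : (D < h)%N -> coef_at q h = 0.
Proof. by rewrite /coef_at ltnNge => /negbTE->. Qed.

Lemma coef_atD q1 q2 h : coef_at (q1 + q2) h = coef_at q1 h + coef_at q2 h.
Proof. by rewrite /coef_at; case: ifP; rewrite ?addr0 // rmorphD mxE. Qed.

Lemma coef_atB q1 q2 h : coef_at (q1 - q2) h = coef_at q1 h - coef_at q2 h.
Proof. by rewrite /coef_at; case: ifP; rewrite ?subr0 // rmorphB !mxE. Qed.

Lemma coef_atC a h : coef_at a%:P h = if h == 0%N then a else 0.
Proof.
rewrite /coef_at; case: ifP => hh; last by case: h hh.
rewrite horner_mx_C mxE -val_eqE /= inordK // mulrb.
by case: ifP.
Qed.

Lemma coef_atZ a q h : coef_at (a%:P * q) h = a * coef_at q h.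
Proof.
rewrite /coef_at; case: ifP; rewrite ?mulr0 // rmorphM /= horner_mx_C.
by rewrite [_ * _]mul_scalar_mx mxE.
Qed.

Lemma coef_at_mulX q h : (h <= D)%N ->
  coef_at ('X * q) h = \sum_(j < D.+1) (p h 1%N j)%:R * coef_at q j.
Proof.
move=> hh; rewrite {1}/coef_at hh rmorphM /= horner_mx_X [_ * _]/(_ *m _) mxE.
apply: eq_bigr => j _; rewrite mxE inordK // /coef_at -ltnS ltn_ord.
by rewrite inord_val.
Qed.

Lemma coef_at_mulX0 q : coef_at ('X * q) 0 = k%:R * coef_at q 1.
Proof. by rewrite coef_at_mulX // sum_p0. Qed.

Lemma coef_at_mulXS q h : (h < D)%N ->
  coef_at ('X * q) h.+1 = (c h.+1)%:R * coef_at q h + (b h.+1)%:R * coef_at q h.+2.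
Proof. by move=> hh; rewrite coef_at_mulX // sum_p // coef_at_gtD. Qed.

(** Each factor X lengthens the walks that the coefficients count by one step. *)
Lemma coef_at_support m q : (forall h, (m <= h)%N -> coef_at q h = 0) ->
  forall h, (m < h)%N -> coef_at ('X * q) h = 0.
Proof.
move=> q0 [//|h] mh; have [hh|hh] := ltnP h D; last by rewrite coef_at_gtD.
by rewrite coef_at_mulXS // !q0 ?mulr0 ?addr0 //; lia.
Qed.

Section Matrix.

Variables (n : nat) (v : 'I_n.+1 -> X) (r : X -> 'I_n.+1).
Hypotheses (vK : cancel v r) (rK : cancel r v).

Definition indexed_adjmx : 'M[R]_n.+1 := \matrix_(i, j) (e (v i) (v j))%:R.
Local Notation A := indexed_adjmx.

(** Polynomials in a matrix live in a ring of matrices of positive size, so the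
    vertices are numbered by the bijection r; [kernel q] is q of the adjacency
    matrix, read back as a function on pairs of vertices. *)
Definition kernel (q : {poly R}) (y z : X) : R := horner_mx A q (r y) (r z).

Lemma indexed_adjmx_sym : A^T = A.
Proof.
by case: he => e_sym _ _; apply/matrixP=> i j; rewrite !mxE e_sym.
Qed.

Lemma sum_index (f : 'I_n.+1 -> R) : \sum_i f i = \sum_w f (r w).
Proof. by rewrite (reindex r) //; apply: onW_bij; exists v. Qed.

Lemma kernelM q1 q2 y z :
  kernel (q1 * q2) y z = \sum_w kernel q1 y w * kernel q2 w z.
Proof. by rewrite /kernel rmorphM /= [_ * _]/(_ *m _) mxE sum_index. Qed.

Lemma kernelX y z : kernel 'X y z = (e y z)%:R.
Proof. by rewrite /kernel horner_mx_X mxE !rK. Qed.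

Lemma kernelC a y z : kernel a%:P y z = if y == z then a else 0.
Proof.
rewrite /kernel horner_mx_C mxE mulrb (inj_eq (can_inj rK)).
by case: ifP.
Qed.

Lemma kernelD q1 q2 y z : kernel (q1 + q2) y z = kernel q1 y z + kernel q2 y z.
Proof. by rewrite /kernel rmorphD mxE. Qed.

Lemma kernel_sym q y z : kernel q y z = kernel q z y.
Proof. by rewrite /kernel -{1}(trmx_horner_mx q indexed_adjmx_sym) mxE. Qed.

Lemma kernel_eigen a f q y : eigenfunction e a f ->
  \sum_z kernel q y z * f z = q.[a] * f y.
Proof.
case=> _ fA; elim/poly_ind: q y => [|q d IH] y.
  by rewrite horner0 mul0r big1 // => z _; rewrite /kernel rmorph0 mxE mul0r.
rewrite hornerMXaddC mulrDl.
under eq_bigr do rewrite kernelD kernelC mulrDl.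
rewrite big_split /=; congr (_ + _); last first.
  rewrite (bigD1 y) //= eqxx big1 ?addr0 // => z /negbTE zy.
  by rewrite eq_sym zy mul0r.
under eq_bigr do rewrite kernelM mulr_suml.
rewrite exchange_big /= -mulrA [a * _]mulrC mulrA -IH mulr_suml.
apply: eq_bigr => w _; rewrite -mulrA [f w * a]mulrC -fA mulr_sumr.
by apply: eq_bigr => z _; rewrite kernelX mulrA.
Qed.

(** Multiplication by the adjacency matrix acts on functions of the distance as
    [inter_mx], by the definition of distance-regularity. *)
Lemma kernelE q y z : kernel q y z = coef_at q (dist e y z).
Proof.
elim/poly_ind: q y z => [|q d IH] y z.
  by rewrite /kernel /coef_at rmorph0 dist_le_diameter rmorph0 !mxE.
rewrite kernelD coef_atD kernelC coef_atC dist_eq0 //; congr (_ + _).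
rewrite mulrC kernelM coef_at_mulX ?dist_le_diameter // -sum_neighbours.
by apply: eq_bigr => w _; rewrite kernelX IH.
Qed.

Variable theta : nat -> R.
Hypothesis theta_decr : forall i j, (i < j)%N -> (j <= D)%N -> theta j < theta i.
Hypothesis theta_eigen : forall i, (i <= D)%N ->
  exists f, eigenfunction e (theta i) f.

Lemma theta_inj : {in gtn D.+1 &, injective theta}.
Proof.
move=> i j; rewrite !inE !ltnS => iD jD tij.
have [ij|ij|//] := ltngtP i j.
  by have := theta_decr ij jD; rewrite tij ltxx.
by have := theta_decr ij iD; rewrite tij ltxx.
Qed.

(** The characteristic polynomial of [inter_mx] annihilates the adjacency matrix
    by Cayley-Hamilton and [kernelE]; it is monic of degree D + 1 and vanishes at
    the D + 1 distinct eigenvalues. *)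
Lemma theta_annihilates : horner_mx A (\prod_(i < D.+1) ('X - (theta i)%:P)) = 0.
Proof.
pose Q := char_poly inter_mx.
have KQ y z : kernel Q y z = 0.
  by rewrite kernelE /coef_at dist_le_diameter Cayley_Hamilton mxE.
suff <- : Q = \prod_(i < D.+1) ('X - (theta i)%:P).
  by apply/matrixP=> i j; have := KQ (v i) (v j); rewrite /kernel !vK => ->; rewrite mxE.
pose rs := [seq theta i | i <- iota 0 D.+1].
rewrite [LHS](@all_roots_prod_XsubC _ _ rs).
- rewrite (monicP (char_poly_monic _)) scale1r big_map.
  by rewrite -{1}(subn0 D.+1) -/(index_iota 0 D.+1) big_mkord.
- by rewrite size_char_poly size_map size_iota.
- apply/allP => _ /mapP[i + ->]; rewrite mem_iota /= add0n ltnS => iD.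
  have [f fE] := theta_eigen iD; have [[y fy] _] := fE.
  have := kernel_eigen Q y fE; rewrite big1 => [|z _]; last by rewrite KQ mul0r.
  by move/esym/eqP; rewrite mulf_eq0 (negbTE fy) orbF.
- rewrite uniq_rootsE map_inj_in_uniq ?iota_uniq // => i j.
  by rewrite !mem_iota; exact: theta_inj.
Qed.

Lemma kernel_ext q1 q2 : (forall i, (i <= D)%N -> q1.[theta i] = q2.[theta i]) ->
  forall y z, kernel q1 y z = kernel q2 y z.
Proof.
move=> q12 y z; rewrite /kernel.
by rewrite (eq_horner_mx theta_inj theta_annihilates (p := q1) (q := q2)).
Qed.

Lemma kernel_square g : (forall i, (i <= D)%N -> 0 <= g.[theta i]) ->
  exists s : X -> X -> R, forall y z, kernel g y z = \sum_t s t y * s t z.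
Proof.
move=> g0; have [s sE] := horner_mx_square (g := g) theta_inj theta_annihilates g0.
exists (kernel s) => y z; rewrite /kernel sE mxE sum_index.
by apply: eq_bigr => t _; rewrite -!/(kernel _ _ _) kernel_sym.
Qed.


(** * Position of b_2 relative to the eigenvalues *)

Let kernel_coef q h y z : dist e y z = h -> kernel q y z = coef_at q h.
Proof. by move=> <-; exact: kernelE. Qed.

(** X^2 - a, written so that [coef_at_mulX0] and [coef_at_mulXS] apply. *)
Definition sqr_shift (a : R) : {poly R} := 'X * ('X * 1%:P) - a%:P.

Lemma horner_sqr_shift a t : (sqr_shift a).[t] = t ^+ 2 - a.
Proof. by rewrite /sqr_shift !(hornerD, hornerN, hornerM, hornerX, hornerC); ring. Qed.

Lemma coef_at_X h : coef_at ('X * 1%:P) h = (h == 1%N)%:R.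
Proof.
case: h => [|h]; first by rewrite coef_at_mulX0 coef_atC mulr0.
have [hh|hh] := ltnP h D; last first.
  rewrite coef_at_gtD // eqSS; case: h hh => // hh; by have := leq_trans hD hh.
rewrite coef_at_mulXS // !coef_atC mulr0 addr0.
by case: h hh => [|h] _; rewrite ?mulr0 // c1E mulr1.
Qed.

Lemma coef_at_sqr_shift0 a : coef_at (sqr_shift a) 0 = k%:R - a.
Proof. by rewrite coef_atB coef_at_mulX0 coef_at_X coef_atC mulr1. Qed.

Lemma coef_at_sqr_shift2 a : coef_at (sqr_shift a) 2 = (c 2)%:R.
Proof.
rewrite coef_atB coef_at_mulXS ?(leq_trans _ hD) // !coef_at_X coef_atC.
by rewrite mulr1 mulr0 addr0 subr0.
Qed.

Lemma coef_at_sqr_shift_gt2 a h : (2 < h)%N -> coef_at (sqr_shift a) h = 0.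
Proof.
move=> h2; rewrite coef_atB coef_atC (coef_at_support (m := 2)) //.
  by case: h h2 => // h; rewrite subr0.
by case=> [|[|j]] // _; rewrite coef_at_X.
Qed.

Lemma k_split : (k = c 2 + b 2)%N /\ (k = 1 + b 1)%N.
Proof.
by split; [rewrite -(@c_plus_b 2) | rewrite -(@c_plus_b 1) ?c1E] => //;
  apply: leq_trans hD.
Qed.

(** Otherwise g = (X^2 - b_2)(X^2 - k^2) is nonnegative on the spectrum.  In
    terms of the halved graph, of valency k', -g(A) is c_2^2 (H + 1)(k' - H).  Its
    diagonal is k' - k' = 0, while at distance 4 only the term - H^2 contributes,
    and it is nonzero. *)
Lemma b2_lt_nontrivial_bound (t : R) : t < k%:R ^+ 2 ->
  (forall i, (i <= D)%N -> theta i ^+ 2 = k%:R ^+ 2 \/ theta i ^+ 2 <= t) ->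
  (b 2)%:R < t.
Proof.
move=> tk ht; rewrite ltNge; apply/negP => tb.
have [kc kb] := k_split.
have [y [z yz]] := pair_at hD.
pose u := sqr_shift (b 2)%:R.
pose g := 'X * ('X * u) - (k%:R ^+ 2)%:P * u.
have [i iD|s sE] := @kernel_square g.
  have -> : g.[theta i] = (theta i ^+ 2 - (b 2)%:R) * (theta i ^+ 2 - k%:R ^+ 2).
    by rewrite /g !(hornerD, hornerN, hornerM, hornerX, hornerC); ring.
  by case: (ht i iD) => [->|hi]; [rewrite subrr mulr0|apply: mulr_le0; lra].
have g0 : coef_at g 0 = 0.
  rewrite coef_atB coef_atZ coef_at_mulX0 (coef_at_mulXS _ D_gt0).
  rewrite coef_at_sqr_shift0 coef_at_sqr_shift2 c1E.
  have -> : k%:R = (c 2)%:R + (b 2)%:R :> R by rewrite {1}kc natrD.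
  have -> : (b 1)%:R = (c 2)%:R + (b 2)%:R - 1 :> R.
    by rewrite -natrD -kc kb natrD addrC addKr.
  ring.
have g4 : coef_at g 4 = (c 4)%:R * ((c 3)%:R * (c 2)%:R).
  rewrite coef_atB coef_atZ coef_at_mulXS // coef_at_mulXS ?(leq_trans _ hD) //.
  rewrite (coef_at_support (m := 3)) //; last by move=> h; exact: coef_at_sqr_shift_gt2.
  rewrite coef_at_sqr_shift2 !coef_at_sqr_shift_gt2 //.
  by rewrite !mulr0 !addr0 subr0.
have := square_diag0 sE (etrans (kernel_coef g (dist_xx he y)) g0) z.
rewrite (kernel_coef g yz) g4 => /eqP; rewrite !mulf_eq0 !pnatr_eq0.
by rewrite !eqn0Ngt !c_gt0 ?(leq_trans _ hD).
Qed.

(** Otherwise A^2 - b_2 = c_2 (H + 1) is positive semidefinite, but its quadratic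
    form at e_y - 2 e_m + e_z, for a path y, m, z of the halved graph with y and z
    at distance 4, equals c_2 (6 - 8) < 0. *)
Lemma lower_bound_lt_b2 (t : R) :
  (forall i, (i <= D)%N -> t <= theta i ^+ 2) -> t < (b 2)%:R.
Proof.
move=> ht; rewrite ltNge; apply/negP => tb.
have [kc kb] := k_split.
have [y [z yz]] := pair_at hD.
have [m ym mz] := @dist_split _ _ he 2 2 y z yz.
pose u := sqr_shift (b 2)%:R.
have [i iD|s sE] := @kernel_square u.
  by rewrite horner_sqr_shift subr_ge0; apply: le_trans tb (ht i iD).
have : 0 <= \sum_w (s w y - 2 * s w m + s w z) ^+ 2.
  by apply: sumr_ge0 => w _; exact: sqr_ge0.
have -> : \sum_w (s w y - 2 * s w m + s w z) ^+ 2 =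
    kernel u y y + 4 * kernel u m m + kernel u z z - 4 * kernel u y m
    - 4 * kernel u m z + 2 * kernel u y z.
  rewrite !sE !mulr_sumr -!big_split -!sumrB -big_split /=.
  by apply: eq_bigr => w _; ring.
rewrite !(kernel_coef _ (dist_xx he _)) (kernel_coef _ ym) (kernel_coef _ mz).
rewrite (kernel_coef _ yz) coef_at_sqr_shift0 coef_at_sqr_shift2.
rewrite coef_at_sqr_shift_gt2 // {1 2 3}kc natrD.
have : 0 < (c 2)%:R :> R by rewrite ltr0n c_gt0 // (leq_trans _ hD).
lra.
Qed.

(** * The local eigenvalue bound *)

Lemma local_dist_cases x (y z : local_vertex e x) (f : nat -> R) :
  f (dist e (val y) (val z)) =
  f 4%N + (f 0%N - f 4%N) * (y == z)%:R + (f 2%N - f 4%N) * (local_rel e x y z)%:R.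
Proof.
rewrite /local_rel /= -val_eqE /= -(dist_eq0 he).
have /eqP xy := valP y; have /eqP xz := valP z.
set h := dist e _ _.
have hle : (h <= 4)%N.
  have := dist_triangle he x (val y) (val z).
  by rewrite xz (dist_sym he (val y) x) xy.
have hodd : ~~ odd h.
  by rewrite /h (odd_dist he hbip x) xy xz.
by case: h hle hodd => [|[|[|[|[|h]]]]] //= _ _; ring.
Qed.

(** Positivity of w E w^T for E the projection onto the eigenspace of theta_i,
    with the entries of E at distances 0, 2 and 4 related by the three-term
    recurrence. *)
Lemma local_eigenvalue_bound x i (eta : R) (w : local_vertex e x -> R) :
  (i <= D)%N -> theta i ^+ 2 < k%:R ^+ 2 -> (2 <= k)%N ->
  eigenfunction (local_rel e x) eta w -> \sum_y w y = 0 ->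
  0 <= (b 2)%:R * (b 3)%:R + (eta + 1) * (theta i ^+ 2 - (b 2)%:R).
Proof.
move=> iD ik k2 [[y0 wy0] wA] w0.
(* L is the Lagrange polynomial of theta_i, so that L(A) is the projection E. *)
have [L LE] := interpolation (fun j => (j == i)%:R) theta_inj.
pose f := coef_at L.
have [j jD|s sE] := @kernel_square L; first by rewrite LE ?ler0n.
have rec h : (h <= D)%N -> coef_at ('X * L) h = theta i * f h.
  move=> hh; have [y [z yz]] := pair_at hh.
  rewrite -coef_atZ -!(kernel_coef _ yz); apply: kernel_ext => j jD.
  by rewrite !hornerM hornerX hornerC LE //; case: eqVneq => [->//|_]; rewrite !mulr0.
(* A zero diagonal would force E = 0, but E fixes the theta_i-eigenvectors. *)
have f00 : f 0%N != 0.
  apply/negP => /eqP f00.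
  have [g gE] := theta_eigen iD; have [[y gy] _] := gE.
  have := kernel_eigen L y gE; rewrite big1 => [|z _].
    by rewrite LE // eqxx mul1r => /esym/eqP; rewrite (negbTE gy).
  by rewrite (square_diag0 sE) ?mul0r // (kernel_coef _ (dist_xx he y)).
have f0_gt0 : 0 < f 0%N.
  rewrite lt_neqAle eq_sym f00 /= -[f 0%N](kernel_coef L (dist_xx he (val y0))) sE.
  by apply: sumr_ge0 => t _; exact: sqr_ge0.
have w2_gt0 := sum_sqr_gt0 wy0.
(* The right-hand side is the quadratic form of E at w. *)
have form : 0 <= (f 0%N - f 4%N + (f 2%N - f 4%N) * eta) * \sum_y w y ^+ 2.
  have -> : (f 0%N - f 4%N + (f 2%N - f 4%N) * eta) * \sum_y w y ^+ 2 =
      \sum_t (\sum_y s t (val y) * w y) ^+ 2.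
    transitivity (\sum_y \sum_z w y * w z * kernel L (val y) (val z)).
      rewrite mulr_sumr; apply: eq_bigr => y _.
      under eq_bigr => z _ do rewrite kernelE -/f (local_dist_cases y z f).
      rewrite (eq_bigr (fun z => f 4%N * w y * w z
        + (f 0%N - f 4%N) * w y * ((y == z)%:R * w z)
        + (f 2%N - f 4%N) * w y * ((local_rel e x y z)%:R * w z))); last first.
        by move=> z _; ring.
      rewrite !big_split /= -!mulr_sumr w0 wA (bigD1 y) //= eqxx.
      rewrite big1 => [|z zy]; first by rewrite /=; ring.
      by rewrite eq_sym (negbTE zy) mul0r.
    under [RHS]eq_bigr => t _ do rewrite expr2 big_distrlr /=.
    rewrite [RHS]exchange_big; apply: eq_bigr => y _ /=.
    rewrite [RHS]exchange_big; apply: eq_bigr => z _ /=.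
    by rewrite sE mulr_sumr; apply: eq_bigr => t _; ring.
  by apply: sumr_ge0 => t _; exact: sqr_ge0.
move: form; rewrite pmulr_lge0 // => form.
have [kc kb] := k_split.
have k3 : (k = c 3 + b 3)%N by rewrite c_plus_b.
have r0 : k%:R * f 1%N = theta i * f 0%N by rewrite -rec // coef_at_mulX0.
have r1 : f 0%N + (b 1)%:R * f 2%N = theta i * f 1%N.
  by rewrite -rec // coef_at_mulXS // c1E mul1r.
have r2 : (c 2)%:R * f 1%N + (b 2)%:R * f 3%N = theta i * f 2%N.
  by rewrite -rec ?coef_at_mulXS // (leq_trans _ hD).
have r3 : (c 3)%:R * f 2%N + (b 3)%:R * f 4%N = theta i * f 3%N.
  by rewrite -rec ?coef_at_mulXS // (leq_trans _ hD).
have b1E : (b 1)%:R = k%:R - 1 :> R by rewrite [in RHS]kb natrD addrC addKr.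
have b2E : (b 2)%:R = k%:R - (c 2)%:R :> R by rewrite [in RHS]kc natrD addrC addKr.
have b3E : (b 3)%:R = k%:R - (c 3)%:R :> R by rewrite [in RHS]k3 natrD addrC addKr.
(* e1 and e2 are linear combinations of the recurrences r0, r1, r2, r3. *)
have e1 : k%:R * (b 1)%:R * (f 0%N - f 2%N) = (k%:R ^+ 2 - theta i ^+ 2) * f 0%N.
  apply/eqP; rewrite -subr_eq0; apply/eqP.
  transitivity (theta i * (theta i * f 0%N - k%:R * f 1%N)
    + k%:R * (theta i * f 1%N - (f 0%N + (b 1)%:R * f 2%N))); last by rewrite r0 r1; ring.
  by rewrite b1E; ring.
have e2 : (b 2)%:R * (b 3)%:R * (f 2%N - f 4%N) =
    (f 0%N - f 2%N) * (theta i ^+ 2 - (b 2)%:R).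
  apply/eqP; rewrite -subr_eq0; apply/eqP.
  transitivity (
    (b 2)%:R * (theta i * f 3%N - ((c 3)%:R * f 2%N + (b 3)%:R * f 4%N))
    + theta i * (theta i * f 2%N - ((c 2)%:R * f 1%N + (b 2)%:R * f 3%N))
    - (b 2)%:R * (theta i * f 1%N - (f 0%N + (b 1)%:R * f 2%N))
    - theta i * (theta i * f 0%N - k%:R * f 1%N)); last by rewrite r0 r1 r2 r3; ring.
  by rewrite b1E b2E b3E; ring.
have kb_gt0 : 0 < k%:R * (b 1)%:R :> R.
  by rewrite -natrM ltr0n muln_gt0; lia.
have d_gt0 : 0 < f 0%N - f 2%N.
  by rewrite -(pmulr_rgt0 _ kb_gt0) e1 mulr_gt0 // subr_gt0.
rewrite -(pmulr_rge0 _ d_gt0).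
have -> : (f 0%N - f 2%N) *
    ((b 2)%:R * (b 3)%:R + (eta + 1) * (theta i ^+ 2 - (b 2)%:R))
  = (b 2)%:R * (b 3)%:R * (f 0%N - f 2%N) + (eta + 1) *
      ((b 2)%:R * (b 3)%:R * (f 2%N - f 4%N)).
  by rewrite e2; ring.
have -> : (b 2)%:R * (b 3)%:R * (f 0%N - f 2%N) +
   (eta + 1) * ((b 2)%:R * (b 3)%:R * (f 2%N - f 4%N))
  = ((b 2)%:R * (b 3)%:R) * (f 0%N - f 4%N + (f 2%N - f 4%N) * eta) by ring.
by apply: mulr_ge0 => //; rewrite -natrM ler0n.
Qed.


(** * Order and symmetry of the spectrum *)

Hypothesis theta_all : forall a f, eigenfunction e a f ->
  exists2 i, (i <= D)%N & theta i = a.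

Let e_sym y z : e y z = e z y. Proof. by case: he. Qed.

(** The sums of (f y + f z)^2 and of (f y - f z)^2 over the ordered edges (y, z)
    are 2 (k + a) |f|^2 and 2 (k - a) |f|^2. *)
Lemma eigenvalue_le_valency (a : R) f : eigenfunction e a f -> - k%:R <= a <= k%:R.
Proof.
case=> [[y0 fy0] fA].
have f2_gt0 := sum_sqr_gt0 fy0.
have sq (b : R) : \sum_y \sum_z (e y z)%:R * (f y + b * f z) ^+ 2 =
    (k%:R * (1 + b ^+ 2) + 2 * b * a) * \sum_y f y ^+ 2.
  transitivity (\sum_y (k%:R * f y ^+ 2 + 2 * b * a * f y ^+ 2)
      + b ^+ 2 * \sum_z k%:R * f z ^+ 2).
    rewrite [X in _ + _ * X](eq_bigr (fun z => \sum_y (e y z)%:R * f z ^+ 2)); last first.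
      move=> z _; rewrite -mulr_suml -(valencyE z); congr (_ * _).
      by apply: eq_bigr => y _; rewrite e_sym.
    rewrite [X in _ = _ + _ * X]exchange_big mulr_sumr -big_split.
    apply: eq_bigr => y _ /=.
    rewrite -(valencyE y) mulr_suml mulr_sumr.
    have -> : 2 * b * a * f y ^+ 2 = \sum_z 2 * b * f y * ((e y z)%:R * f z).
      by rewrite -mulr_sumr fA; ring.
    by rewrite -!big_split /=; apply: eq_bigr => z _;  ring.
  by rewrite big_split /= -!mulr_sumr; ring.
have pos b : 0 <= k%:R * (1 + b ^+ 2) + 2 * b * a.
  rewrite -(pmulr_lge0 _ f2_gt0) -sq; apply: sumr_ge0 => y _; apply: sumr_ge0 => z _.
  by rewrite mulr_ge0 ?ler0n ?sqr_ge0.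
by have := pos 1; have := pos (-1); rewrite !expr2; lra.
Qed.

Lemma valency_eigenfunction : eigenfunction e k%:R (fun=> 1 : R).
Proof.
split; first by exists x0; exact: oner_neq0.
by move=> y; rewrite mulr1 -(valencyE y); apply: eq_bigr => z _; rewrite mulr1.
Qed.

(** Neighbours have distances from x0 of different parity. *)
Lemma opp_eigenfunction (a : R) f : eigenfunction e a f ->
  eigenfunction e (- a) (fun y => (-1) ^+ dist e x0 y * f y).
Proof.
case=> [[y0 fy0] fA]; split; first by exists y0; rewrite mulf_neq0 // signr_eq0.
move=> y; rewrite mulNr mulrCA -fA mulr_sumr -sumrN; apply: eq_bigr => z _.
have [eyz|_] := boolP (e y z); last by rewrite !mul0r mulr0 oppr0.
have := odd_dist he hbip x0 y z; have /eqP-> : dist e y z == 1%N by rewrite dist_eq1.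
rewrite -(signr_odd _ (dist e x0 y)) -(signr_odd _ (dist e x0 z)).
by case: (odd (dist e x0 y)); case: (odd (dist e x0 z)) => //= _; ring.
Qed.

(** The spectrum is closed under negation, and a strictly decreasing enumeration
    of a finite set is unique. *)
Lemma theta_rev i : (i <= D)%N -> theta (D - i)%N = - theta i.
Proof.
move=> iD.
suff : mkseq (fun j => - theta (D - j)%N) D.+1 = mkseq theta D.+1.
  move/(congr1 (nth 0 ^~ (D - i)%N)).
  by rewrite !nth_mkseq ?ltnS ?leq_subr // subKn.
have opp_in j : (j <= D)%N -> - theta j \in mkseq theta D.+1.
  move=> jD; have [f /opp_eigenfunction/theta_all[l lD <-]] := theta_eigen jD.
  by apply/mapP; exists l; rewrite // mem_iota.
apply: (irr_sorted_eq (leT := >%O)).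
- exact: rev_trans lt_trans.
- exact: ltxx.
- apply/(sortedP 0) => j; rewrite size_mkseq => jD.
  by rewrite !nth_mkseq //= 1?ltnW // ltrN2; apply: theta_decr; lia.
- apply/(sortedP 0) => j; rewrite size_mkseq => jD.
  by rewrite !nth_mkseq //= 1?ltnW //; apply: theta_decr.
move=> a; apply/mapP/idP => [[j _ ->]|].
  by apply: opp_in; rewrite leq_subr.
case/mapP=> j; rewrite mem_iota add0n ltnS => jD ->.
have /mapP[l] := opp_in j jD; rewrite mem_iota add0n ltnS => lD jl.
exists (D - l)%N; first by rewrite mem_iota add0n ltnS leq_subr.
by rewrite subKn // -jl opprK.
Qed.

Lemma theta_anti i j : (i <= j)%N -> (j <= D)%N -> theta j <= theta i.
Proof.
by rewrite leq_eqVlt => /orP[/eqP->//|ij jD]; apply/ltW/theta_decr.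
Qed.

Lemma theta0E : theta 0%N = k%:R.
Proof.
have [[|j] jD tj] := theta_all valency_eigenfunction; first by [].
have [f /eigenvalue_le_valency/andP[_]] := theta_eigen (leq0n D).
by rewrite leNgt -tj theta_decr.
Qed.

Lemma theta1_bounds : theta 1%N ^+ 2 < k%:R ^+ 2 /\
  forall i, (i <= D)%N -> theta i ^+ 2 = k%:R ^+ 2 \/ theta i ^+ 2 <= theta 1%N ^+ 2.
Proof.
have t10 : theta 1%N < k%:R by rewrite -theta0E theta_decr.
have t1_gt0 : 0 < theta 1%N.
  have : theta (D - 1)%N < theta 1%N by apply: theta_decr; lia.
  rewrite theta_rev //; lra.
split; first by rewrite ltr_pXn2r // nnegrE; lra.
move=> i iD; case: (posnP i) => [->|i0]; first by left; rewrite theta0E.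
have [->|iD'] := eqVneq i D.
  by left; rewrite -(subn0 D) theta_rev // sqrrN theta0E.
right; have : theta i <= theta 1%N by exact: theta_anti.
have : theta (D - 1)%N <= theta i by apply: theta_anti; lia.
by rewrite theta_rev // => h1 h2; nra.
Qed.

(** theta_d is the smallest nonnegative eigenvalue: d = D - d or d + 1 = D - d,
    and theta_{D - d} = - theta_d. *)
Lemma thetad_bound i : (i <= D)%N -> theta D./2 ^+ 2 <= theta i ^+ 2.
Proof.
have dD : (D./2 <= D)%N by lia.
have td_ge0 : 0 <= theta D./2.
  have : theta (D - D./2)%N <= theta D./2 by apply: theta_anti; lia.
  rewrite theta_rev //; lra.
move=> iD; have [id|id] := leqP i D./2.
  by have := theta_anti id dD; nra.
have : theta i <= theta (D - D./2)%N by apply: theta_anti => //; lia.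
by rewrite theta_rev //; nra.
Qed.

Lemma local_eigenvalue_theta_tilde x (eta : R) (w : local_vertex e x -> R) :
  (3 <= k)%N -> eigenfunction (local_rel e x) eta w -> \sum_y w y = 0 ->
  theta_tilde p (theta 1%N) <= eta <= theta_tilde p (theta D./2).
Proof.
move=> k3 wA w0.
have dD : (D./2 <= D)%N by lia.
have [t1k t1max] := theta1_bounds.
have t1 := b2_lt_nontrivial_bound t1k t1max.
have td := lower_bound_lt_b2 thetad_bound.
have D1 : (1 <= D)%N := D_gt0.
have tdk := le_lt_trans (thetad_bound D1) t1k.
have h1 := local_eigenvalue_bound D1 t1k (ltnW k3) wA w0.
have hd := local_eigenvalue_bound dD tdk (ltnW k3) wA w0.
rewrite /theta_tilde /inter_b; apply/andP; split.
  suff : - (eta + 1) <= (b 2)%:R * (b 3)%:R / (theta 1%N ^+ 2 - (b 2)%:R) by lra.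
  by rewrite ler_pdivlMr ?subr_gt0 //; lra.
suff : eta + 1 <= (b 2)%:R * (b 3)%:R / - (theta D./2 ^+ 2 - (b 2)%:R).
  by rewrite invrN mulrN; lra.
by rewrite ler_pdivlMr ?oppr_gt0 ?subr_lt0 //; lra.
Qed.

End Matrix.

End Kernels.

(** * The graph on Gamma_2(x) *)

Lemma local_rel_sym (X : finType) (e : rel X) (x : X) :
  simple_connected_graph e -> symmetric (local_rel e x).
Proof. by move=> he y z; rewrite /local_rel /= dist_sym. Qed.

Lemma local_valency (R : nzRingType) (X : finType) (e : rel X)
    (p : nat -> nat -> nat -> nat) (x : X) (y : local_vertex e x) :
  simple_connected_graph e -> distance_regular e p -> (2 <= diameter e)%N ->
  \sum_z (local_rel e x y z)%:R = (p 2%N 2%N 2%N)%:R :> R.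
Proof.
move=> he hdr D2; have /eqP xy := valP y.
rewrite -(hdr 2 2 2 D2 D2 D2 _ _ xy)%N -sum1_card natr_sum.
rewrite (eq_bigl (fun w => (dist e x w == 2%N) && (dist e w (val y) == 2%N))); last first.
  by move=> w; rewrite inE.
rewrite big_mkcondr /= (reindex_omap (val : local_vertex e x -> X) insub) /=; last first.
  by move=> w xw; rewrite insubT.
rewrite [RHS](eq_bigl xpredT); last by case=> w xw /=; rewrite insubT ?xw /= eqxx.
apply: eq_bigr => z _; rewrite /local_rel /= (dist_sym he (val z)).
by case: (_ == _).
Qed.

Theorem theorem11p4 (R : rcfType) (X : finType) (e : rel X) (D : nat)
    (p : nat -> nat -> nat -> nat) (theta : nat -> R) (x : X) (eta : nat -> R)
    (he : simple_connected_graph e)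
    (hbip : bipartite e)
    (hdiam : diameter e = D)
    (hdr : distance_regular e p)
    (hD : (4 <= D)%N)
    (hk : (3 <= valency p)%N)
    (htheta : distinct_eigenvalues (adjmx R e) D theta)
    (heta : eigenvalues_with_mult (adjmx R (local_rel e x))
              (ith_valency p 2) eta)
    (heta1 : eta 1%N = (p 2%N 2%N 2%N)%:R)
    (hetak : forall i : nat, (2 <= i <= valency p)%N ->
               eta i = (inter_b p 3)%:R - 1) :
  forall i : nat, ((valency p).+1 <= i <= ith_valency p 2)%N ->
    theta_tilde p (theta 1%N) <= eta i <= theta_tilde p (theta D./2).
Proof.
move: htheta; rewrite -hdiam in hD * => -[theta_decr theta_eig] i /andP[ki ik2].
have e_sym : symmetric e by case: he.
have i2 : (1 < i)%N by lia.
have [w [w0 wM wsum]] : exists w : 'rV[R]_#|local_vertex e x|,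
    [/\ w != 0, w *m adjmx R (local_rel e x) = eta i *: w & \sum_j w 0 j = 0].
  apply: (@regular_cofactor_eigenvector _ _ _ (eta 1%N) _
            (\prod_(2 <= j < (ith_valency p 2).+1) ('X - (eta j)%:P))).
  - by apply/matrixP=> a b; rewrite !mxE local_rel_sym.
  - move=> a; rewrite heta1 -(local_valency R (enum_val a) he hdr (leq_trans _ hD)) //.
    rewrite [RHS](reindex (@enum_val _ (local_vertex e x))) /=; last first.
      exact/onW_bij/enum_val_bij.
    by apply: eq_bigr => b _; rewrite mxE.
  - by rewrite heta big_ltn //; lia.
  - rewrite /root horner_prod; apply/eqP.
    rewrite (big_cat_nat (n := i)) /=; [|lia|lia].
    by rewrite (big_ltn (m := i)) ?hornerXsubC ?subrr ?mul0r ?mulr0 // ltnS.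
pose f y := w 0 (enum_rank y).
have f_eig : eigenfunction (local_rel e x) (eta i) f.
  split; first by case/rV0Pn: w0 => a wa; exists (enum_val a); rewrite /f enum_valK.
  move=> y; move/rowP: wM => /(_ (enum_rank y)); rewrite !mxE => <-.
  rewrite [RHS](reindex (@enum_rank _)) /=; last exact/onW_bij/enum_rank_bij.
  by apply: eq_bigr => z _; rewrite mxE !enum_rankK local_rel_sym // mulrC.
have f_sum : \sum_y f y = 0.
  rewrite -[RHS]wsum [RHS](reindex (@enum_rank (local_vertex e x))) //=.
  exact/onW_bij/enum_rank_bij.
have X1 : #|X|.-1.+1 = #|X| by rewrite prednK //; apply/card_gt0P; exists x.
pose v (a : 'I_#|X|.-1.+1) : X := enum_val (cast_ord X1 a).
pose r (y : X) := cast_ord (esym X1) (enum_rank y).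
have vK : cancel v r by move=> a; rewrite /r /v enum_valK cast_ordK.
have rK : cancel r v by move=> y; rewrite /r /v cast_ordKV enum_rankK.
apply: (local_eigenvalue_theta_tilde he hbip hdr hD x vK rK theta_decr _ _ hk f_eig f_sum).
- by move=> j jD; apply/(eigenvalue_adjmxP _ e_sym)/theta_eig; exists j.
- by move=> a g gE; apply/theta_eig/(eigenvalue_adjmxP _ e_sym); exists g.
Qed.
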